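(* Let $S$ be a Coe-semigroup of embedding dimension three with minimal system of generators $\mathrm{msg}(S)=\{n_1,n_2,n_3\}$, where $n_3$ is an odd integer. Then: (1) $F(S)=n_3+\frac{n_1n_2}{2}-n_1-n_2$; (2) $g(S)=\frac{n_3-1}{2}+\left(\frac{n_1}{2}-1\right)\left(\frac{n_2}{2}-1\right)$.
   Context: $\mathbb{N}=\{0,1,2,\ldots\}$. A numerical semigroup is a subset of $\mathbb{N}$ containing $0$, closed under addition and with finite complement in $\mathbb{N}$. A numerical semigroup $S$ is a Coe-semigroup if $\{x-1,x+1\}\subseteq S$ for every odd $x\in S$. $F(S)=\max(\mathbb{Z}\setminus S)$; $g(S)$ is the cardinality of $\mathbb{N}\setminus S$; $\mathrm{msg}(S)$ is the (unique, finite) minimal system of generators of $S$ as a submonoid of $(\mathbb{N},+)$, and the embedding dimension is its cardinality (so here $n_1,n_2,n_3$ are pairwise distinct). *)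

(* Defs.v *)
From mathcomp Require Import all_boot all_order all_algebra finmap.
From mathcomp Require Import boolp classical_sets functions cardinality.

Set Implicit Arguments.
Unset Strict Implicit.
Unset Printing Implicit Defensive.

Import Order.TTheory GRing.Theory Num.Theory.

Local Open Scope classical_set_scope.

Definition submonoid (M : set nat) : Prop :=
  M 0 /\ forall x y, M x -> M y -> M (x + y).

Definition numerical_semigroup (S : set nat) : Prop :=
  submonoid S /\ finite_set (~` S).

(* An odd [x] is positive, so the predecessor is a genuine subtraction. *)
Definition coe_semigroup (S : set nat) : Prop :=
  numerical_semigroup S /\
  forall x, S x -> odd x -> [set x.-1; x.+1] `<=` S.

(* Integers outside [S]: all negative integers belong to this set, so the
   Frobenius number of [setT] is -1. *)
Definition gapsZ (S : set nat) : set int := ~` (Posz @` S).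

(* The maximum of [gapsZ S]; [frobeniusP] shows that the default value is
   irrelevant for numerical semigroups. *)
Definition frobenius (S : set nat) : int :=
  xget 0%R (gapsZ S `&` ubound (gapsZ S)).

Definition genus (S : set nat) : nat := #|` fset_set (~` S)|.

Definition generated (A : set nat) : set nat := smallest submonoid A.

Definition minimal_generators (S A : set nat) : Prop :=
  generated A = S /\ forall B, B `<=` A -> generated B = S -> B = A.

(* Every submonoid of nat has exactly one minimal system of generators
   ([msgP], [msg_unique]); it is selected here by choice. *)
Definition msg (S : set nat) : set nat := xget set0 (minimal_generators S).

Definition embedding_dimension (S : set nat) : nat := #|` fset_set (msg S)|.

Lemma generated_submonoid A : submonoid (generated A).
Proof.
split=> [M [[]]//|x y Ax Ay M MA].
by case: (MA) => -[_ +] _; apply; [exact: Ax|exact: Ay].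
Qed.

Lemma sub_generated A : A `<=` generated A.
Proof. by move=> x Ax M [_]; apply. Qed.

Lemma generated_min A M : submonoid M -> A `<=` M -> generated A `<=` M.
Proof. by move=> sM AM x; apply. Qed.

Definition irreducibles (S : set nat) : set nat :=
  [set x | [/\ S x, x <> 0 &
    forall y z, S y -> S z -> x = y + z -> y = 0 \/ z = 0]].

Lemma irreducibles_sub S A : generated A = S -> irreducibles S `<=` A.
Proof.
move=> AS x [Sx x0 irr]; apply: contrapT => nAx.
have sM : submonoid (S `\ x).
  have [S0 SD] : submonoid S by rewrite -AS; exact: generated_submonoid.
  split=> [|y z [Sy yx] [Sz zx]]; first by split=> // /esym.
  split; first exact: SD.
  move=> /= yzx; case: (irr y z Sy Sz (esym yzx)) => e; move: yzx; rewrite e.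
    by rewrite add0n => /zx.
  by rewrite addn0 => /yx.
have := @generated_min A _ sM; rewrite AS => /(_ _ x Sx) [|_]; last exact.
move=> y Ay; split; first by rewrite -AS; exact: sub_generated.
by move=> /= yx; apply: nAx; rewrite -yx.
Qed.

Lemma generated_irreducibles S : submonoid S -> generated (irreducibles S) = S.
Proof.
move=> sS; apply/seteqP; split; first by apply: generated_min => // x [].
move=> x; have [n] := ubnP x; elim: n x => // n IH x xn Sx.
have [G0 GD] := generated_submonoid (irreducibles S).
have [->//|/eqP x0] := eqVneq x 0.
apply: contrapT => nG; apply: (nG); apply: sub_generated; split=> // y z Sy Sz e.
have [->|y0] := posnP y; first by left.
have [->|z0] := posnP z; first by right.
exfalso; apply: nG; rewrite e; apply: GD; apply: IH => //.
  by apply: (@leq_trans x); [rewrite e -addn1 leq_add2l|exact: xn].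
by apply: (@leq_trans x); [rewrite e -add1n leq_add2r|exact: xn].
Qed.

Lemma minimal_generatorsE S A : submonoid S ->
  minimal_generators S A <-> A = irreducibles S.
Proof.
move=> sS; split=> [[AS min]|->].
  by apply/esym/min; [exact: irreducibles_sub|exact: generated_irreducibles].
split=> [|B BI BS]; first exact: generated_irreducibles.
by apply/seteqP; split=> //; exact: irreducibles_sub.
Qed.

Lemma msgP S : submonoid S -> minimal_generators S (msg S).
Proof.
move=> sS; apply: (@xgetPex _ set0 (minimal_generators S)).
by exists (irreducibles S); apply/minimal_generatorsE.
Qed.

Lemma msg_unique S A : submonoid S -> minimal_generators S A -> A = msg S.
Proof.
move=> sS /(minimal_generatorsE _ sS) ->.
by apply/esym/(minimal_generatorsE _ sS)/msgP.
Qed.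

Lemma frobeniusP S : numerical_semigroup S ->
  (gapsZ S `&` ubound (gapsZ S)) (frobenius S).
Proof.
move=> [_ /finite_fsetP[X SX]]; apply: xgetPex.
have Sp n : S n \/ n \in X.
  have [Sn|nS] := pselect (S n); first by left.
  by right; have : (~` S) n by []; rewrite SX.
have Xp n : n \in X -> ~ S n by move=> nX; have : [set` X] n by []; rewrite -SX.
have [X0|[n nX]] : (forall n, n \notin X) \/ exists n, n \in X.
  by have [->|[n nX]] := fset_0Vmem X; [left=> n; rewrite inE|right; exists n].
  exists (Negz 0); split; first by case.
  move=> [n []|[|n] _ //]; exists n => //.
  by case: (Sp n) => //; rewrite (negPf (X0 n)).
have bX m : m \in X -> m <= \max_(i <- enum_fset X) i.
  by move=> mX; apply: leq_bigmax_seq.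
case: (ex_maxnP (ex_intro (fun i => i \in X) n nX) bX) => m mX mmax.
exists (Posz m); split; first by case=> k Sk [km]; apply: (Xp m mX); rewrite -km.
move=> [k nSk|k _ //]; rewrite lez_nat; apply: mmax.
by case: (Sp k) => // Sk; case: nSk; exists k.
Qed.

(* Main.v *)
(** If [m] is the least odd element of [S], then [m - 1] and [m + 1] are in
    [S]; were there a second odd generator, both would be multiples of the
    third generator, which would then be [2] and make the second odd generator
    redundant.  So [n3 = m] is the only odd generator, and [n3 - 1], [n3 + 1]
    lie in [<n1, n2> = 2T] with [T = <a, b>], [n1 = 2a], [n2 = 2b].  Hence
    [a], [b] are coprime and [2 n3] is in [2T], so [S] is the disjoint union
    of [2T] and [n3 + 2T].  Both formulas follow from Sylvester's symmetry of
    [T]: with [c = (a - 1)(b - 1)], exactly one of the integers [n] and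
    [c - 1 - n] is in [T]. *)
Require Import Defs.
From mathcomp Require Import all_boot all_order all_algebra finmap.
From mathcomp Require Import boolp classical_sets functions cardinality.
From mathcomp Require Import zify ring.

Import Order.TTheory GRing.Theory Num.Theory.

Local Open Scope classical_set_scope.

(** * Sylvester's symmetry for two coprime generators *)

Definition span2 (a b n : nat) : Prop := exists x y, n = x * a + y * b.

Lemma span2_0 a b : span2 a b 0.
Proof. by exists 0, 0. Qed.

Lemma span2D a b m n : span2 a b m -> span2 a b n -> span2 a b (m + n).
Proof.
by move=> [x [y ->]] [z [t ->]]; exists (x + z), (y + t); rewrite !mulnDl addnACA.
Qed.

Lemma span2Ml a b k n : span2 a b n -> span2 a b (k * n).
Proof.
by move=> [x [y ->]]; exists (k * x), (k * y); rewrite mulnDr !mulnA.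
Qed.

Section Sylvester.
Variables a b : nat.
Hypotheses (a0 : 0 < a) (b0 : 0 < b) (ab : coprime a b).

(** The conductor of [T], so that [c - 1 = a * b - a - b]. *)
Let c := a.-1 * b.-1.

(** As [a] is invertible modulo [b], some [x * a] with [x < b] is congruent to [n]; the cases are
    [x * a <= n] and [n < x * a]. *)
Lemma span2_residue n :
  exists2 x, x < b & (exists y, n = x * a + y * b) \/
                     (exists y, x * a = n + y.+1 * b).
Proof.
have [u ub] : exists u, u * a = n %[mod b].
  case: (egcdnP b a0) => u v e _; exists (u * n).
  move: ab; rewrite /coprime => /eqP g1.
  by rewrite mulnAC e g1 mulnDl mul1n mulnAC modnMDl.
exists (u %% b); first by rewrite ltn_mod.
have : (u %% b) * a = n %[mod b] by rewrite modnMml.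
set x := u %% b; move=> e.
have [xn|nx] := leqP (x * a) n.
  left; exists ((n - x * a) %/ b); rewrite divnK ?subnKC//.
  by rewrite -eqn_mod_dvd// e.
right; exists ((x * a - n) %/ b).-1.
have bd : b %| x * a - n by rewrite -eqn_mod_dvd ?(ltnW nx)// e.
rewrite prednK ?divnK ?subnKC ?(ltnW nx)//.
by rewrite divn_gt0// dvdn_leq// subn_gt0.
Qed.

(** In the second case of [span2_residue], [n = x * a - (y + 1) * b] is at most
    [(b - 1) * a - b = c - 1]. *)
Lemma span2_ge n : c <= n -> span2 a b n.
Proof.
move=> cn; have [x xb [[y ->]|[y e]]] := span2_residue n; first by exists x, y.
exfalso; move: cn e xb; rewrite /c.
case: a a0 => // a' _; case: b b0 => // b' _ /=; nia.
Qed.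

Lemma span2_sym n : n < c -> span2 a b n <-> ~ span2 a b (c.-1 - n).
Proof.
move=> nc; split=> [[x [y e]] [z [t e']]|].
  (* Were [n] and [c - 1 - n] both in [T], their sum would be [a * b - a - b]. *)
  have abE : (x + z).+1 * a + (y + t).+1 * b = a * b.
    move: nc e e'; rewrite /c; case: a a0 => // a' _; case: b b0 => // b' _ /=.
    nia.
  (* By coprimality [b] divides [x + z + 1], so the first summand alone is at least [a * b]. *)
  have : b %| (x + z).+1 * a.
    by rewrite -(dvdn_addl _ (dvdn_mull (y + t).+1 (dvdnn b))) abE dvdn_mull.
  rewrite Gauss_dvdl 1?coprime_sym// => /dvdn_leq-/(_ isT) bxz.
  have := leq_mul bxz (leqnn a); rewrite -(leq_add2r ((y + t).+1 * b)) abE.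
  by rewrite mulnC; lia.
move=> nT; have [x xb [[y ->]|[y e]]] := span2_residue n; first by exists x, y.
(* From [n = x * a - (y + 1) * b] follows [c - 1 - n = (b - 1 - x) * a + y * b]. *)
exfalso; apply: nT; exists (b.-1 - x), y.
move: nc e xb; rewrite /c; case: a a0 => // a' _; case: b b0 => // b' _ /=.
move=> nc e xb.
have [d dE] : exists d, b' = x + d by exists (b' - x); lia.
rewrite dE in nc e *; rewrite addKn; nia.
Qed.

(** The symmetry pairs [i] with [c - 1 - i], so adding the sum to its reversal counts 1 for each
    [i < c]. *)
Lemma span2_gaps : (\sum_(0 <= i < c) ~~ `[<span2 a b i>]) * 2 = c.
Proof.
rewrite muln2 -addnn {2}big_nat_rev -big_split /=.
rewrite -{3}(subn0 c) -[RHS]muln1 -sum_nat_const_nat.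
apply: eq_big_nat => i /andP[_ ic].
have -> : 0 + c - i.+1 = c.-1 - i by lia.
have [T|T] := asboolP (span2 a b i).
  by have/asboolPn/negbTE -> := (span2_sym _ ic).1 T.
suff -> : `[<span2 a b (c.-1 - i)>] by [].
by apply/asboolP; apply: contrapT => /(span2_sym _ ic).2.
Qed.

Lemma span2_gaps_ge N : c <= N ->
  \sum_(0 <= i < N) ~~ `[<span2 a b i>] = \sum_(0 <= i < c) ~~ `[<span2 a b i>].
Proof.
move=> cN; rewrite (big_cat_nat (n := c))//=.
rewrite [X in _ + X]big_nat_cond [X in _ + X]big1 ?addn0// => i /andP[/andP[ci _] _].
by have/asboolT -> := span2_ge _ ci.
Qed.

End Sylvester.

(** * Computing the genus and the Frobenius number *)

Lemma genusE (S : set nat) N : (forall n, N <= n -> S n) ->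
  genus S = \sum_(0 <= i < N) ~~ `[<S i>].
Proof.
move=> SN; rewrite /genus.
have -> : ~` S = [set` [fset i in [seq i <- iota 0 N | ~~ `[<S i>]]]%fset].
  apply/seteqP; split=> n /=; rewrite !inE/= mem_filter mem_iota/= add0n.
    by move=> nS; rewrite asboolF//= ltnNge; apply/negP => /SN.
  by move=> /andP[/asboolPn].
rewrite set_fsetK card_fseq undup_id ?filter_uniq ?iota_uniq//.
rewrite size_filter -sum1_count big_mkcond /index_iota subn0.
by apply: eq_bigr => i _; case: asboolP.
Qed.

Lemma frobeniusE (S : set nat) f : numerical_semigroup S ->
  ~ S f -> (forall n, f < n -> S n) -> frobenius S = Posz f.
Proof.
move=> nS Sf Sgt; have [gF ubF] := frobeniusP nS.
apply/eqP; rewrite eq_le; apply/andP; split; last first.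
  by apply: ubF => -[n Sn [nf]]; apply: Sf; rewrite -nf.
case: (frobenius S) gF => [k gk|//].
rewrite lez_nat leqNgt; apply/negP => /Sgt Sk; apply: gk; by exists k.
Qed.

Lemma sum_nat_even_odd (F : nat -> nat) N :
  \sum_(0 <= i < N.*2) F i =
  \sum_(0 <= i < N) F i.*2 + \sum_(0 <= i < N) F i.*2.+1.
Proof.
elim: N => [|N IH]; first by rewrite !big_geq.
by rewrite doubleS !big_nat_recr//= IH; lia.
Qed.

(** * Invariants of the union of [2T] and [2m + 1 + 2T] *)

Section DoubledSpan.
Variables (S : set nat) (a b m : nat).
Hypotheses (a0 : 0 < a) (b0 : 0 < b) (ab : coprime a b)
  (Seven : forall k, S k.*2 <-> span2 a b k)
  (Sodd : forall k, S k.*2.+1 <-> m <= k /\ span2 a b (k - m)).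

Let c := a.-1 * b.-1.

(** Here [n3 = 2m + 1]. The largest odd gap is [n3 + 2(c - 1)], and it exceeds every even gap. *)
Lemma frobenius_doubled : numerical_semigroup S -> 0 < m ->
  frobenius S = Posz (m + c).*2.-1.
Proof.
move=> nS m0.
apply: frobeniusE => // [|n].
  have -> : (m + c).*2.-1 = (m + c).-1.*2.+1 by lia.
  (* As [0 < m], [mc] excludes [c = 0]; then [c - 1] mirrors [0] and so is not in [T]. *)
  move=> /Sodd[mc]; have c0 : 0 < c by lia.
  have -> : (m + c).-1 - m = c.-1 - 0 by lia.
  by apply: (span2_sym _ _ a0 b0 ab _ c0).1; exact: span2_0.
rewrite -(odd_double_half n); case: (odd n) => /= cn.
  apply/Sodd; split; first by lia.
  by apply: span2_ge => //; rewrite -/c; lia.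
by apply/Seven; apply: span2_ge => //; rewrite -/c; lia.
Qed.

(** The [c / 2] gaps of [T] give [c / 2] even gaps and as many odd gaps above [n3]; the other gaps
    are the [m] odd numbers below [n3]. *)
Lemma genus_doubled : genus S = m + c.
Proof.
rewrite (genusE _ (m + c).*2); last first.
  move=> n; rewrite -(odd_double_half n); case: (odd n) => /= cn.
    apply/Sodd; split; first by lia.
    by apply: span2_ge => //; rewrite -/c; lia.
  by apply/Seven; apply: span2_ge => //; rewrite -/c; lia.
rewrite sum_nat_even_odd.
under eq_bigr do rewrite (asbool_equiv_eq (Seven _)).
rewrite span2_gaps_ge ?leq_addl//.
rewrite [X in _ + X](big_cat_nat (n := m)) ?leq_addr//=.
have -> : \sum_(0 <= i < m) ~~ `[<S i.*2.+1>] = m.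
  rewrite -[RHS]muln1 -{2}(subn0 m) -sum_nat_const_nat.
  apply: eq_big_nat => i /andP[_ im].
  by rewrite asboolF// => /Sodd[]; rewrite leqNgt im.
rewrite -{2}(add0n m) big_addn addKn.
under [X in _ + (_ + X)]eq_bigr => i _.
  have -> : `[<S (i + m).*2.+1>] = `[<span2 a b i>].
    apply: asbool_equiv_eq; split=> [/Sodd[_]|Ti]; first by rewrite addnK.
    by apply/Sodd; rewrite addnK leq_addl.
  over.
by have := span2_gaps _ _ a0 b0 ab; rewrite -/c; lia.
Qed.

End DoubledSpan.

(** * Generators of a Coe-semigroup of embedding dimension three *)

Lemma submonoidM (S : set nat) k n : submonoid S -> S n -> S (k * n).
Proof.
move=> [S0 SD] Sn; elim: k => // k IH; rewrite mulSn; exact: SD.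
Qed.

Lemma generated3P n1 n2 n3 n : generated [set n1; n2; n3] n ->
  exists x y z, n = x * n1 + y * n2 + z * n3.
Proof.
move=> /(_ [set n | exists x y z, n = x * n1 + y * n2 + z * n3]) /=.
apply; split; first split; first by exists 0, 0, 0.
  move=> _ _ [x [y [z ->]]] [x' [y' [z' ->]]].
  by exists (x + x'), (y + y'), (z + z'); rewrite !mulnDl; lia.
by move=> _ /= [[|]|] ->; [exists 1, 0, 0|exists 0, 1, 0|exists 0, 0, 1]; lia.
Qed.

Lemma irreducible1 {S : set nat} {n} : submonoid S -> S 1 ->
  irreducibles S n -> n = 1.
Proof.
move=> sS S1 [Sn n0 irr].
have Sn1 : S n.-1 by rewrite -(muln1 n.-1); exact: submonoidM.
by case: (irr n.-1 1 Sn1 S1); lia.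
Qed.

(** Used twice: to identify [n3] as the least odd element, then to show that [n1] and [n2] are
    even. *)
Lemma one_odd_generator (S : set nat) m n q : coe_semigroup S ->
  irreducibles S = [set m; n; q] -> odd m -> odd n -> m < n ->
  (forall k, S k -> odd k -> m <= k) -> False.
Proof.
move=> [[sS _] coe] irrE om on mn min.
have In : irreducibles S n by rewrite irrE; left; right.
have [Sn _ irrn] := In.
have [Sm _ _] : irreducibles S m by rewrite irrE; left; left.
have [Sq _ _] : irreducibles S q by rewrite irrE; right.
have rep k : S k -> exists x y z, k = x * m + y * n + z * q.
  by rewrite -(generated_irreducibles sS) irrE; exact: generated3P.
have m1 : m <> 1 by move=> m1; rewrite m1 in Sm; have := irreducible1 sS Sm In; lia.
have Smp : S m.-1 by apply: (coe _ Sm om); left.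
have SmS : S m.+1 by apply: (coe _ Sm om); right.
have [x [y [z e]]] := rep _ Smp.
have [x' [y' [z' e']]] := rep _ SmS.
(* [m] and [n] exceed [m - 1], so only [q] can contribute to it. *)
have [x0 y0] : x = 0 /\ y = 0 by nia.
rewrite x0 y0 in e.
have qm : q < m by case: z e => [|z]; rewrite ?mulSn; lia.
have eq : ~~ odd q by apply/negP => /(min _ Sq); rewrite leqNgt qm.
(* Both being odd, [n >= m + 2]. *)
have y'0 : y' = 0 by case: y' e' => // y'; rewrite mulSn; lia.
(* [2m > m + 1], and [x' = 1] would make [1] a multiple of the even [q]. *)
have x'0 : x' = 0.
  have [//|x'1] : x' = 0 \/ x' = 1.
    by case: x' e' => [|[|x']]; rewrite ?mulSn; lia.
  have /eqP : z' * q = 1 by rewrite x'1 y'0 in e'; lia.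
  by rewrite muln_eq1 => /andP[_ /eqP q1]; rewrite q1 in eq.
rewrite y'0 x'0 in e'.
(* [q] is even and divides [(m + 1) - (m - 1)]. *)
have q2 : q = 2.
  have qz : q * (z' - z) = 2 by rewrite mulnBr; lia.
  have : q %| 2 by rewrite -qz dvdn_mulr.
  by move=> /dvdn_leq-/(_ isT); case: q eq qz {irrE Sq rep e e' qm} => [|[|[|q]]].
have Snm : S (n - m).
  have -> : n - m = (n - m)./2 * q by rewrite q2; lia.
  exact: submonoidM.
by case: (irrn m (n - m) Sm Snm); lia.
Qed.

(** If the least odd element is a sum, one summand is odd, hence no smaller, and the other is 0. So
    it is a generator; were it not [n3], two generators would be odd. *)
Lemma odd_generator_min (S : set nat) n1 n2 n3 : coe_semigroup S ->
  irreducibles S = [set n1; n2; n3] -> odd n3 ->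
  forall k, S k -> odd k -> n3 <= k.
Proof.
move=> coeS irrE on3 k Sk ok; have [[sS _] _] := coeS.
have ex : exists k, odd k && `[<S k>] by exists k; rewrite ok; apply/asboolP.
case: (ex_minnP ex) => m /andP[om /asboolP Sm] mmin.
have min j : S j -> odd j -> m <= j by move=> Sj oj; apply: mmin; rewrite oj; exact/asboolP.
suff <- : m = n3 by exact: min.
have Im : irreducibles S m.
  split=> //; first by case: m om {Sm mmin min}.
  move=> y z Sy Sz e.
  have [oy|ey] := boolP (odd y); first by have := min _ Sy oy; right; lia.
  have oz : odd z by move: om; rewrite e oddD (negbTE ey).
  by have := min _ Sz oz; left; lia.
have S3 : S n3 by have [] : irreducibles S n3 by rewrite irrE; right.
have := min _ S3 on3; rewrite leq_eqVlt => /predU1P[//|m3].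
exfalso; move: (Im); rewrite irrE => -[[|]|] /= mE; last by lia.
- apply: (@one_odd_generator S m n3 n2) => //.
  by rewrite irrE mE setUAC.
- apply: (@one_odd_generator S m n3 n1) => //.
  by rewrite irrE mE (setUC [set n1]) setUAC.
Qed.

Lemma even_generators (S : set nat) n1 n2 n3 : coe_semigroup S ->
  irreducibles S = [set n1; n2; n3] -> odd n3 -> n1 <> n3 -> n2 <> n3 ->
  ~~ odd n1 /\ ~~ odd n2.
Proof.
move=> coeS irrE on3 n13 n23; have min := odd_generator_min _ _ _ _ coeS irrE on3.
have [S1 _ _] : irreducibles S n1 by rewrite irrE; left; left.
have [S2 _ _] : irreducibles S n2 by rewrite irrE; left; right.
split; apply/negP => o.
- apply: (@one_odd_generator S n3 n1 n2) => //; last by have := min _ S1 o; lia.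
  by rewrite irrE setUC setUA.
- apply: (@one_odd_generator S n3 n2 n1) => //; last by have := min _ S2 o; lia.
  by rewrite irrE setUC (setUC [set n1]) setUA.
Qed.

Lemma coe_semigroup3 (S : set nat) n1 n2 n3 : coe_semigroup S ->
  irreducibles S = [set n1; n2; n3] -> odd n3 -> n1 <> n3 -> n2 <> n3 ->
  exists a b m, [/\ n1 = a.*2, n2 = b.*2, n3 = m.*2.+1 &
    [/\ 0 < a, 0 < b, 0 < m & coprime a b] /\
    (forall k, S k.*2 <-> span2 a b k) /\
    (forall k, S k.*2.+1 <-> m <= k /\ span2 a b (k - m))].
Proof.
move=> coeS irrE on3 n13 n23; have [[sS _] coe] := coeS.
have min := odd_generator_min _ _ _ _ coeS irrE on3.
have [e1 e2] := even_generators _ _ _ _ coeS irrE on3 n13 n23.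
have I1 : irreducibles S n1 by rewrite irrE; left; left.
have [S1 n10 _] := I1.
have [S2 n20 _] : irreducibles S n2 by rewrite irrE; left; right.
have [S3 _ _] : irreducibles S n3 by rewrite irrE; right.
have n31 : n3 <> 1.
  by move=> n31; rewrite n31 in S3; move: e1; rewrite (irreducible1 sS S3 I1).
have [a aE] : exists a, n1 = a.*2 by exists n1./2; lia.
have [b bE] : exists b, n2 = b.*2 by exists n2./2; lia.
have [m mE] : exists m, n3 = m.*2.+1 by exists n3./2; lia.
have rep k : S k -> exists t z, span2 a b t /\ k = t.*2 + z * n3.
  rewrite -(generated_irreducibles sS) irrE => /generated3P[x [y [z ->]]].
  by exists (x * a + y * b), z; split; [exists x, y|rewrite aE bE; lia].
have spanS k : span2 a b k -> S k.*2.
  move=> [x [y ->]]; have -> : (x * a + y * b).*2 = x * n1 + y * n2 by lia.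
  by apply: sS.2; exact: submonoidM.
(* [n3 - 1 = 2m] is too small to involve [n3]. *)
have Tm : span2 a b m.
  have : S m.*2 by apply: (coe _ S3 on3); left; rewrite mE.
  move=> /rep[t [z [Tt e]]]; have -> // : m = t.
  by case: z e => [|z]; rewrite ?mulSn; lia.
(* In [2m + 2], a single [n3] is ruled out by parity, and two or more by size, as [m > 0]. *)
have TmS : span2 a b m.+1.
  have : S m.+1.*2 by apply: (coe _ S3 on3); right; rewrite mE.
  move=> /rep[t [z [Tt e]]]; have -> // : m.+1 = t.
  by case: z e => [|[|z]]; rewrite ?mulSn; lia.
(* [n3 = m + (m + 1)], so pairs of copies of [n3] are absorbed into [2T]. *)
have T3 : span2 a b n3 by rewrite mE -addnn -addnS; exact: span2D.
have Srep k : S k -> exists t, span2 a b t /\ (k = t.*2 \/ k = n3 + t.*2).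
  move=> /rep[t [z [Tt ->]]]; exists (t + z./2 * n3); split.
    by apply: span2D => //; exact: span2Ml.
  rewrite -{1 3}(odd_double_half z); case: (odd z); [right|left]; lia.
exists a, b, m; split=> //; split; first split; [lia|lia|lia| |].
  (* The gcd divides the consecutive members [m] and [m + 1] of [T]. *)
  rewrite /coprime -dvdn1.
  have gT t : span2 a b t -> gcdn a b %| t.
    by move=> [x [y ->]]; rewrite dvdn_add// dvdn_mull ?dvdn_gcdl ?dvdn_gcdr.
  by rewrite -(@dvdn_addr m) ?addn1; exact: gT.
split=> k; split.
- by move=> /Srep[t [Tt [e|e]]]; [have -> : k = t by lia|lia].
- exact: spanS.
- move=> /Srep[t [Tt [e|e]]]; first by lia.
  have -> : k = m + t by lia.
  by rewrite leq_addr addKn.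
- move=> [mk /spanS Sk]; have -> : k.*2.+1 = n3 + (k - m).*2 by lia.
  by apply: sS.2.
Qed.

(** * Both formulas over the rationals *)

Local Open Scope ring_scope.

Theorem proposition55 (S : set nat) (n1 n2 n3 : nat)
    (coeS : coe_semigroup S)
    (edimS : embedding_dimension S = 3%N)
    (msgS : msg S = [set n1; n2; n3])
    (odd_n3 : odd n3) :
  (frobenius S)%:~R = n3%:R + n1%:R * n2%:R / 2%:R - n1%:R - n2%:R :> rat /\
  (genus S)%:R = (n3%:R - 1) / 2%:R
    + (n1%:R / 2%:R - 1) * (n2%:R / 2%:R - 1) :> rat.
Proof.
have [nS _] := coeS; have sS := nS.1.
have irrE : irreducibles S = [set n1; n2; n3].
  by rewrite -msgS; apply/esym/(minimal_generatorsE _ sS)/msgP.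
have cardE : #|` [fset n1; n2; n3]%fset| = 3%N.
  rewrite -edimS /embedding_dimension msgS.
  suff -> : [set n1; n2; n3] = [set` [fset n1; n2; n3]%fset] by rewrite set_fsetK.
  apply/seteqP; split=> x /=; rewrite !inE -?orbA.
    by move=> [[|]|] ->; rewrite eqxx ?orbT.
  by case/or3P => /eqP ->; [left; left|left; right|right].
have /andP[/eqP n13 /eqP n23] : (n1 != n3) && (n2 != n3).
  (* Otherwise there would be at most two generators. *)
  rewrite -negb_or; apply/negP => n3in; move: cardE.
  have -> : [fset n1; n2; n3]%fset = [fset n1; n2]%fset.
    apply/fsetP => x; rewrite !inE.
    by case: eqP => //= ?; case: eqP => //= ?; apply/eqP; case/orP: n3in => /eqP; congruence.
  by rewrite cardfs2; case: eqP.
have [a [b [m [-> -> -> [[a0 b0 m0 ab] [Se So]]]]]] :=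
  coe_semigroup3 _ _ _ _ coeS irrE odd_n3 n13 n23.
rewrite (frobenius_doubled _ _ _ _ a0 b0 ab Se So nS m0).
rewrite (genus_doubled _ _ _ _ a0 b0 ab Se So).
(* Writing [a], [b], [m] as successors removes the truncated predecessors before casts are
   expanded. *)
case: a a0 {ab Se So} => // a _; case: b b0 => // b _; case: m m0 => // m _ /=.
rewrite doubleD doubleS addSn /= -!muln2 -pmulrn.
by split; rewrite -?natr1 !(natrD, natrM) -?natr1 ?natrM -?natr1; field.
Qed.
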